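(* Consider the stochastic approximation process with expanding projections $(\theta_i,X_i)_{i\ge 0}$ described in the context. Assume that the Lyapunov condition (W) stated in the context holds (with constant $M_0$), and that for any $(\theta,x)\in\mathcal{R}_0\times\mathsf{X}$ the following hold: (N1) $\mathbb{P}_{\theta,x}\bigl(\lim_{i\to\infty}\Gamma_{i+1}\,|\nabla w(\theta_i)|\cdot|H(\theta_i,X_{i+1})|=0\bigr)=1$; (N2) $\mathbb{E}_{\theta,x}\bigl[\sum_{i=0}^\infty\Gamma_{i+1}^2|H(\theta_i,X_{i+1})|^2\bigr]<\infty$; (N3) $\mathbb{E}_{\theta,x}\bigl[\sup_{k\ge 0}\bigl|\sum_{i=0}^k\Gamma_{i+1}\langle\nabla w(\theta_i),\bar H(\theta_i,X_{i+1})\rangle\bigr|\bigr]<\infty$; (D) $\delta_i:=\inf_{\theta\in\mathcal{R}_i\setminus\mathcal{W}_{M_0}}-\langle\nabla w(\theta),h(\theta)\rangle>0$ for each $i$, and $\sum_{i=1}^\infty\Gamma_i\delta_i=\infty$ $\mathbb{P}_{\theta,x}$-almost surely; (N4) $\lim_{m\to\infty}\sup_{k>m}\bigl|\sum_{i=m}^k\Gamma_{i+1}\langle\nabla w(\theta_i),\bar H(\theta_i,X_{i+1})\rangle\bigr|=0$ $\mathbb{P}_{\theta,x}$-almost surely. Then for any $M>M_0$ the tails of the trajectories of $(\theta_i)$ are eventually contained within $\mathcal{W}_M$ $\mathbb{P}_{\theta,x}$-a.s., that is, $$\mathbb{P}_{\theta,x}\Bigl(\bigcup_{m\ge0}\bigcap_{n\ge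 m}\{\theta_n\in\mathcal{W}_M\}\Bigr)=1 .$$
   Context: Setting. Let $\Theta\subset\mathbb{R}^d$ and let $(\mathsf{X},\mathcal{B}(\mathsf{X}))$ be a measurable space. Let $\{P_\theta\}_{\theta\in\Theta}$ be a family of Markov transition probabilities on $\mathsf{X}$ with stationary distributions $\{\pi_\theta\}_{\theta\in\Theta}$, respectively, and let $H:\Theta\times\mathsf{X}\to\mathbb{R}^d$ be measurable. Put $h(\theta):=\int_{\mathsf{X}}H(\theta,x)\,\pi_\theta(\mathrm{d}x)$ and $\bar H(\theta,x):=H(\theta,x)-h(\theta)$. $\langle\cdot,\cdot\rangle$ and $|\cdot|$ denote the standard inner product and norm on $\mathbb{R}^d$. Process. Let $\{\mathcal{R}_i\}_{i\ge0}$ be subsets of $\Theta$ and let the step sizes $(\Gamma_i)_{i\ge1}$ be nonnegative random variables. For a starting point $(\theta_0,X_0)\equiv(\theta,x)\in\mathcal{R}_0\times\mathsf{X}$ and recursively for $i\ge0$: $X_{i+1}\mid\mathcal{F}_i\sim P_{\theta_i}(X_i,\cdot)$; $\theta_{i+1}^*=\theta_i+\Gamma_{i+1}H(\theta_i,X_{i+1})$; $\theta_{i+1}=\theta_{i+1}^*\mathbb{I}\{\theta_{i+1}^*\in\mathcal{R}_{i+1}\}+\theta_{i+1}^{\mathrm{proj}}\mathbb{I}\{\theta_{i+1}^*\notin\mathcal{R}_{i+1}\}$, where $\mathcal{F}_i$ is the $\sigma$-algebra generated by $\theta_0,X_0,\theta_1,X_1,\Gamma_1,\ldots,\theta_i,X_i,\Gamma_i$,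 and $\theta_{i+1}^{\mathrm{proj}}$ is a $\sigma(\mathcal{F}_i,X_{i+1},\theta_{i+1}^* )$-measurable random variable taking values in $\mathcal{R}_{i+1}$. $\mathbb{P}_{\theta,x}$ and $\mathbb{E}_{\theta,x}$ denote the law of this process started at $(\theta,x)$ and the corresponding expectation. For $M>0$, $\mathcal{W}_M:=\{\theta\in\Theta: w(\theta)\le M\}$, and $A^c$ denotes complement. Condition (W). There exists a twice continuously differentiable function $w:\Theta\to[0,\infty)$ such that (i) the Hessian matrix $\mathrm{Hess}_w:\Theta\to\mathbb{R}^{d\times d}$ is bounded: $C_w:=\sup_{\theta\in\Theta}\sup_{|\theta_0|=1}|\mathrm{Hess}_w(\theta)\theta_0|<\infty$; (ii) the projection sets are increasing subsets of $\Theta$, that is, $\mathcal{R}_i\subset\mathcal{R}_{i+1}$ for all $i\ge0$, and $\hat\Theta:=\bigcup_{i=0}^\infty\mathcal{R}_i\subset\Theta$; (iii) there is a constant $M_0>0$ such that $\langle\nabla w(\theta),h(\theta)\rangle\le0$ for any $\theta\in\mathcal{W}_{M_0}^c\cap\hat\Theta$; (iv) for all $i\ge1$, whenever $\theta_i^*\notin\mathcal{R}_i$, one has $\theta_i^{\mathrm{proj}}\in\mathcal{R}_i$ and $w(\theta_i^{\mathrm{proj}})\le w(\theta_i^* )$, $\mathbb{P}_{\theta,x}$-a.s.; (v) there are constants $\alpha_w,c\in[0,\infty)$ and a non-decreasing sequence of constants $\xi_i\in[1,\infty)$ with $\sup_{\theta\in\mathcal{R}_i}|\nabla w(\theta)|\le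 c\,\xi_i^{\alpha_w}$ for all $i\ge0$.
   Formalization: Added: almost surely every segment from θ_i to θ*_{i+1} lies in Θ (automatic for convex Θ containing the θ*_i); and in (D) every tail of ΣΓ_iδ_i diverges, which differs from the text only when some δ_i = +∞ because R_i ⊂ W_{M0}. *)

(* Defs.v *)
From HB Require Import structures.
From mathcomp Require Import all_boot all_order all_algebra.
From mathcomp Require Import all_classical all_reals all_analysis.
From mathcomp Require Import measurable_realfun.

Set Implicit Arguments.
Unset Strict Implicit.
Unset Printing Implicit Defensive.
Import Order.TTheory GRing.Theory Num.Theory.
Import numFieldNormedType.Exports.
Local Open Scope classical_set_scope.
Local Open Scope ring_scope.

Section Euclidean.
Context {R : realType} {d : nat}.
Implicit Types u v th : 'rV[R]_d.

Definition dotv u v : R := \sum_(j < d) u ord0 j * v ord0 j.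

(* The library norm on 'rV[R]_d is the sup norm; this is the Euclidean one. *)
Definition enorm v : R := Num.sqrt (dotv v v).

Definition grad (w : 'rV[R]_d -> R) th : 'rV[R]_d :=
  \row_(j < d) 'D_(delta_mx ord0 j) w th.

Definition hess (w : 'rV[R]_d -> R) th : 'M[R]_d :=
  \matrix_(i < d, j < d)
    'D_(delta_mx ord0 i) (fun t => grad w t ord0 j) th.

(* [w] is twice continuously differentiable on [Theta]. A function on a subset
   of R^d is represented by a total function; as Theta need not be open, it is
   required to be C^2 on some open neighbourhood of Theta (which may be Theta
   itself when Theta is open). *)
Definition C2_on (Theta : set 'rV[R]_d) (w : 'rV[R]_d -> R) : Prop :=
  exists U : set 'rV[R]_d,
    [/\ open U, Theta `<=` U,
        forall th, U th -> differentiable w th,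
        forall th, U th -> differentiable (grad w) th &
        forall th, U th -> {for th, continuous (hess w)}].

Definition sublevel (Theta : set 'rV[R]_d) (w : 'rV[R]_d -> R) (M : R) :
  set 'rV[R]_d := [set th | Theta th /\ w th <= M].

End Euclidean.

(* R^d with its Borel sigma-algebra. *)
Definition borel_rV (R : realType) (d : nat) :=
  g_sigma_algebraType (@open 'rV[R]_d).

(* Measurability, for the trace sigma-algebra, of the restriction of [f] to a
   subset [D] which is not assumed to be measurable itself. *)
Definition trace_measurable d1 d2 (T1 : measurableType d1)
    (T2 : measurableType d2) (D : set T1) (f : T1 -> T2) : Prop :=
  forall B, measurable B ->
    exists2 C, measurable C & D `&` f @^-1` B = D `&` C.

Section SigmaAlgebras.
Context {T : Type}.

(* The sets {f \in B}, for B measurable. *)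
Definition sigma_fun d2 (T2 : sigmaRingType d2) (f : T -> T2) : set (set T) :=
  [set f @^-1` B | B in measurable].

Definition measurable_wrt (G : set (set T)) d2 (T2 : sigmaRingType d2)
    (f : T -> T2) : Prop := forall B, measurable B -> G (f @^-1` B).

End SigmaAlgebras.

(* The data of a stochastic approximation with expanding projections. Objects
   indexed by Theta are represented by total functions on R^d, whose values
   outside Theta are irrelevant. [sa_prob th x] is the law P_{th,x} of the
   process started at (th, x), for th in sa_R 0. The values [sa_Gamma 0] and
   [sa_proj 0] are not used. *)
Record sa_system (R : realType) (d : nat) (dX dO : measure_display)
    (X : measurableType dX) (Omega : measurableType dO) := SASystem {
  sa_Theta : set 'rV[R]_d;
  sa_P : 'rV[R]_d -> R.-pker X ~> X;
  sa_pi : 'rV[R]_d -> probability X R;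
  sa_H : 'rV[R]_d -> X -> 'rV[R]_d;
  sa_R : nat -> set 'rV[R]_d;
  sa_prob : 'rV[R]_d -> X -> probability Omega R;
  sa_theta : nat -> Omega -> 'rV[R]_d;
  sa_X : nat -> Omega -> X;
  sa_Gamma : nat -> Omega -> R;
  sa_proj : nat -> Omega -> 'rV[R]_d
}.

Section StochasticApproximation.
Context {R : realType} {d : nat} {dX dO : measure_display}
  {X : measurableType dX} {Omega : measurableType dO}.
Variable S : sa_system R d X Omega.

Local Notation Theta := (sa_Theta S).
Local Notation H := (sa_H S).
Local Notation theta := (sa_theta S).
Local Notation Xp := (sa_X S).
Local Notation Gamma := (sa_Gamma S).
Local Notation proj := (sa_proj S).
Local Notation Rset := (sa_R S).
Local Notation Pr := (sa_prob S).

(* h(th) = \int H(th, x) pi_th(dx), componentwise *)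
Definition sa_h (th : 'rV[R]_d) : 'rV[R]_d :=
  \row_(j < d) \int[sa_pi S th]_x (H th x ord0 j).

Definition sa_Hbar (th : 'rV[R]_d) (x : X) : 'rV[R]_d := H th x - sa_h th.

(* H(theta_i, X_{i+1}) *)
Definition sa_incr (i : nat) (o : Omega) : 'rV[R]_d :=
  H (theta i o) (Xp i.+1 o).

(* [sa_star i] is theta^*_{i+1} (the index is shifted by one). *)
Definition sa_star (i : nat) (o : Omega) : 'rV[R]_d :=
  theta i o + Gamma i.+1 o *: sa_incr i o.

(* F_i, generated by theta_0, X_0 and theta_j, X_j, Gamma_j, 1 <= j <= i *)
Definition sa_F (i : nat) : set (set Omega) :=
  <<s \bigcup_(j in [set j | (j <= i)%N])
        (sigma_fun (theta j : Omega -> borel_rV R d) `|` sigma_fun (Xp j))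
      `|` \bigcup_(j in [set j | (1 <= j <= i)%N]) sigma_fun (Gamma j) >>.

(* sigma(F_i, X_{i+1}, theta^*_{i+1}) *)
Definition sa_Fstar (i : nat) : set (set Omega) :=
  <<s sa_F i `|` sigma_fun (Xp i.+1)
      `|` sigma_fun (sa_star i : Omega -> borel_rV R d) >>.

(* The standing assumptions on the Markov kernels, on H and on the process. *)
Record sa_setting : Prop := SASetting {
  sa_R_sub : forall i, Rset i `<=` Theta;
  sa_stationary : forall th, Theta th -> forall A, measurable A ->
    (\int[sa_pi S th]_x sa_P S th x A = sa_pi S th A)%E;
  sa_H_measurable :
    trace_measurable (T1 := (borel_rV R d * X)%type) (T2 := borel_rV R d)
      [set p | Theta p.1] (fun p => H p.1 p.2);
  (* implicit in the definition of h *)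
  sa_H_integrable : forall th, Theta th -> forall j,
    (sa_pi S th).-integrable setT (fun x => (H th x ord0 j)%:E);
  sa_theta_measurable :
    forall i, measurable_fun setT (theta i : Omega -> borel_rV R d);
  sa_X_measurable : forall i, measurable_fun setT (Xp i);
  sa_Gamma_measurable : forall i, measurable_fun setT (Gamma i.+1);
  sa_Gamma_ge0 : forall i o, 0 <= Gamma i.+1 o;
  sa_theta0 : forall o, Rset 0%N (theta 0%N o);
  sa_init : forall th x, Rset 0%N th ->
    \forall o \ae Pr th x, theta 0%N o = th /\ Xp 0%N o = x;
  (* P_{theta_i}(X_i, .) is a version of the law of X_{i+1} given F_i *)
  sa_transition : forall th x, Rset 0%N th -> forall i A, measurable A ->
    measurable_wrt (sa_F i)
      (fun o => sa_P S (theta i o) (Xp i o) A) /\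
    forall B, sa_F i B ->
      (Pr th x (B `&` Xp i.+1 @^-1` A)
       = \int[Pr th x]_(o in B) sa_P S (theta i o) (Xp i o) A)%E;
  sa_recursion : forall i o, theta i.+1 o =
    if `[< Rset i.+1 (sa_star i o) >] then sa_star i o else proj i.+1 o;
  sa_proj_measurable : forall i,
    measurable_wrt (sa_Fstar i) (proj i.+1 : Omega -> borel_rV R d);
  sa_proj_in : forall i o, Rset i.+1 (proj i.+1 o)
}.

(* Almost surely, all the segments [theta_i, theta^*_{i+1}] lie in Theta. This
   holds trivially when Theta = R^d, and when Theta is convex and contains all
   the theta^*_i. For a general Theta, w(theta^*_i) only makes sense when
   theta^*_i is in Theta, and the Hessian bound controls
   w(theta^*_{i+1}) - w(theta_i) only along a segment contained in Theta. *)
Definition sa_steps_in_Theta : Prop :=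
  forall th x, Rset 0%N th ->
    \forall o \ae Pr th x, forall i (t : R), 0 <= t <= 1 ->
      Theta (theta i o + t *: (sa_star i o - theta i o)).

Section Lyapunov.
Variables (w : 'rV[R]_d -> R) (M0 : R).

Record condition_W : Prop := ConditionW {
  W_C2 : C2_on Theta w;
  W_ge0 : forall th, Theta th -> 0 <= w th;
  W_hess : (ereal_sup [set z | exists th u, [/\ Theta th, enorm u = 1%R &
              z = (enorm (hess w th *m u^T)^T)%:E]] < +oo)%E;
  W_incr : forall i, Rset i `<=` Rset i.+1;
  W_union : \bigcup_i Rset i `<=` Theta;
  W_M0 : 0 < M0;
  W_drift : forall th,
    (~` sublevel Theta w M0 `&` \bigcup_i Rset i) th ->
    dotv (grad w th) (sa_h th) <= 0;
  W_proj : forall th x, Rset 0%N th ->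
    \forall o \ae Pr th x, forall i, ~ Rset i.+1 (sa_star i o) ->
      Rset i.+1 (proj i.+1 o) /\ w (proj i.+1 o) <= w (sa_star i o);
  W_growth : exists (alpha c : R) (xi : nat -> R),
    [/\ 0 <= alpha, 0 <= c, forall i, 1 <= xi i,
        {homo xi : i j / (i <= j)%N >-> i <= j} &
        forall i, (ereal_sup [set (enorm (grad w th))%:E | th in Rset i]
                   <= (c * xi i `^ alpha)%:E)%E]
}.

(* Gamma_{i+1} <grad w(theta_i), Hbar(theta_i, X_{i+1})> *)
Definition sa_noise (i : nat) (o : Omega) : R :=
  Gamma i.+1 o *
  dotv (grad w (theta i o)) (sa_Hbar (theta i o) (Xp i.+1 o)).

(* The infimum is +oo when sa_R i is contained in the sublevel set. *)
Definition sa_delta (i : nat) : \bar R :=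
  ereal_inf [set (- dotv (grad w th) (sa_h th))%:E |
               th in Rset i `\` sublevel Theta w M0].

(* Divergence of the series \sum_i Gamma_i delta_i, at the sample point o. For
   finite delta_i this is equivalent to \sum_(i >= 1) Gamma_i delta_i = +oo; it
   is asked of all the tails so that an infinite delta_i (with
   sa_R i contained in the sublevel set) for finitely many i does not make the
   series diverge by itself. *)
Definition sa_delta_divergence (o : Omega) : Prop :=
  forall m : nat, (1 <= m)%N ->
    (\sum_(m <= i <oo) (Gamma i o)%:E * sa_delta i = +oo)%E.

End Lyapunov.

End StochasticApproximation.

(* Main.v *)
Require Import Defs.
From HB Require Import structures.
From mathcomp Require Import all_boot all_order all_algebra.
From mathcomp Require Import all_classical all_reals all_analysis.
From mathcomp Require Import measurable_realfun.
From mathcomp Require Import lra.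

Set Implicit Arguments.
Unset Strict Implicit.
Unset Printing Implicit Defensive.
Import Order.TTheory GRing.Theory Num.Theory.
Import numFieldNormedType.Exports.
Local Open Scope classical_set_scope.
Local Open Scope ring_scope.

(** Along a trajectory, a second-order expansion of w and the monotonicity of the
    projection step (w at the projected point is at most w before projection)
    give
<<
      w(theta_(i+1)) <= w(theta_i) + Gamma_(i+1) <grad w(theta_i), h(theta_i)>
                          + noise_i + C Gamma_(i+1)^2 |H(theta_i, X_(i+1))|^2
>>
    (sa_lyapunov_step). Almost surely, the sums of the last two terms over all
    late blocks of indices are small: for the noise this is a Cauchy property
    (small_blocks_of_tail_sup), for the remainder it is the convergence of the
    series of squares (small_blocks_of_finite_series), whose expectation is
    finite.

    While w(theta_i) > M0, the drift term is at most - Gamma_(i+1) delta_(i+1),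
    because delta is nonincreasing; as these quantities have a divergent sum and
    w >= 0, the trajectory must return to the level M0 after any given time
    (descent_recurrence). When it leaves this level, the first jump is bounded by
    Gamma_(i+1) |grad w(theta_i)| |H(theta_i, X_(i+1))| plus the remainder, which
    tends to 0; afterwards the drift is nonpositive until the next return, so w
    grows only by a block of noise and remainder terms. Hence w(theta_n) <=
    M0 + eps for all large n (descent_tail, sa_path_tail).

    The argument is pathwise; probability enters only through the almost sure
    finiteness of the series of squares (sa_step_sq_ae_finite) and the
    measurability of the limiting event (measurable_sa_sublevel). As Theta may
    fail to be measurable, both rely on theta_i taking all its values in Theta:
    this makes trace sets of Theta, or an open neighbourhood of Theta, as good
    as Theta itself. *)

(** * Descent of a perturbed Lyapunov sequence *)

Lemma descent_telescope (R : realType) (v g e : nat -> R) (m n : nat) :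
  (m <= n)%N ->
  (forall i, (m <= i < n)%N -> v i.+1 <= v i - g i + e i) ->
  v n <= v m - \sum_(m <= i < n) g i + \sum_(m <= i < n) e i.
Proof.
elim: n => [|n IHn] mn step.
  by move: mn; rewrite leqn0 => /eqP ->; rewrite !big_geq//; lra.
move: mn; rewrite leq_eqVlt => /predU1P[->|mn]; first by rewrite !big_geq//; lra.
rewrite !big_nat_recr//=.
have mn' : (m <= n)%N by [].
have step_n := step n; rewrite mn' ltnSn in step_n.
have step_lt i : (m <= i < n)%N -> v i.+1 <= v i - g i + e i.
  by move=> /andP[mi ni]; apply: step; rewrite mi ltnS ltnW.
by have := IHn mn' step_lt; have := step_n isT; lra.
Qed.

(** The deterministic core. Above the level M0 the sequence v loses g and gains
    at most e, where sums of e over late blocks are small. Since the sum of g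
    diverges as long as v stays above M0, v returns to M0; after that, an
    excursion above M0 consists of one exit jump and one block of errors, both
    small. *)
Section DescentTail.
Variables (R : realType) (v g e : nat -> R) (M0 : R).
Hypothesis v_ge0 : forall i, 0 <= v i.
Hypothesis g_ge0 : forall i, M0 < v i -> 0 <= g i.
Hypothesis descent : forall i, M0 < v i -> v i.+1 <= v i - g i + e i.
Hypothesis small_jump : forall eps, 0 < eps ->
  exists N, forall i, (N <= i)%N -> v i <= M0 -> v i.+1 <= M0 + eps.
Hypothesis small_error : forall eps, 0 < eps ->
  exists N, forall a b, (N <= a <= b)%N -> \sum_(a <= i < b) e i <= eps.
Hypothesis divergence : forall m, (forall i, (m <= i)%N -> M0 < v i) ->
  forall B, exists2 n, (m <= n)%N & B < \sum_(m <= i < n) g i.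

(** If v stayed above M0 from some time on, telescoping would make the
    nonnegative v n fall below zero as soon as the sum of g exceeds v m + 1,
    where m is so late that the errors after m add up to at most 1. *)
Lemma descent_recurrence (N : nat) : exists2 m, (N <= m)%N & v m <= M0.
Proof.
apply: contrapT => noreturn.
have above i : (N <= i)%N -> M0 < v i.
  by move=> Ni; rewrite ltNge; apply/negP => vi; apply: noreturn; exists i.
have [N1 errN1] := small_error ltr01.
pose m := maxn N N1.
have abovem i : (m <= i)%N -> M0 < v i.
  by move=> mi; apply: above; rewrite (leq_trans _ mi)// leq_maxl.
have [n mn gn] := divergence abovem (v m + 1).
have tele : v n <= v m - \sum_(m <= i < n) g i + \sum_(m <= i < n) e i.
  by apply: descent_telescope => // i /andP[mi _]; exact/descent/abovem.
have err : \sum_(m <= i < n) e i <= 1 by apply: errN1; rewrite leq_maxr.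
by have := v_ge0 n; lra.
Qed.

(** Once a late visit at time m is fixed, v n is compared with v k, where k is
    the time just after the last visit before n (and k = m if n = m); one exit
    jump and one block of errors separate v n from M0. *)
Lemma descent_tail (eps : R) : 0 < eps ->
  exists m, forall n, (m <= n)%N -> v n <= M0 + eps.
Proof.
move=> eps0; have eps2 : 0 < eps / 2 by lra.
have [N1 jumpN1] := small_jump eps2.
have [N2 errN2] := small_error eps2.
have [m Nm vm] := descent_recurrence (maxn N1 N2).
move: Nm; rewrite geq_max => /andP[N1m N2m].
exists m => n mn.
have [k [/andP[mk kn] vk vn]] : exists k, [/\ (m <= k <= n)%N,
    v k <= M0 + eps / 2 & v n <= v k + \sum_(k <= i < n) e i].
  elim: n mn => [|n IHn] mn.
    exists 0%N; split; first by rewrite mn.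
      by move: mn vm; rewrite leqn0 => /eqP -> v0; lra.
    by rewrite big_geq// addr0.
  move: mn; rewrite leq_eqVlt => /predU1P[<-|mn].
    by exists m; split; rewrite ?leqnn ?leqnSn// ?big_geq//; lra.
  have mn' : (m <= n)%N by [].
  have [vn|vn] := leP (v n) M0.
    (* v n is below M0, so the comparison time restarts just after n. *)
    exists n.+1; split; first by rewrite leqnn andbT ltnW.
      by apply: jumpN1 => //; exact: leq_trans mn'.
    by rewrite big_geq// addr0.
  have [k [/andP[mk kn] vk vnk]] := IHn mn'.
  exists k; split => //; first by rewrite mk ltnW.
  rewrite big_nat_recr//=.
  by have := descent vn; have := g_ge0 vn; lra.
have := errN2 k n; rewrite kn andbT (leq_trans N2m mk) => /(_ isT) ?; lra.
Qed.
End DescentTail.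

(** * Euclidean inner product *)

Section Euclid.
Variables (R : realType) (d : nat).
Implicit Types u v x : 'rV[R]_d.

Lemma dotvC u v : dotv u v = dotv v u.
Proof. by apply: eq_bigr => j _; rewrite mulrC. Qed.

Lemma dotvDr u v x : dotv u (v + x) = dotv u v + dotv u x.
Proof. by rewrite -big_split; apply: eq_bigr => j _; rewrite mxE mulrDr. Qed.

Lemma dotvZr (a : R) u v : dotv u (a *: v) = a * dotv u v.
Proof. by rewrite mulr_sumr; apply: eq_bigr => j _; rewrite mxE mulrCA. Qed.

Lemma dotv_ge0 u : 0 <= dotv u u.
Proof. by apply: sumr_ge0 => j _; rewrite -expr2 sqr_ge0. Qed.

Lemma dotv_eq0 u : dotv u u = 0 -> u = 0.
Proof.
move=> /eqP; rewrite psumr_eq0; last by move=> j _; rewrite -expr2 sqr_ge0.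
move=> /allP u0; apply/rowP => j; rewrite mxE; apply/eqP.
by have := u0 j (mem_index_enum j); rewrite mulf_eq0 orbb.
Qed.

Lemma enorm_sq u : enorm u ^+ 2 = dotv u u.
Proof. by rewrite sqr_sqrtr// dotv_ge0. Qed.

Lemma enorm_ge0 u : 0 <= enorm u. Proof. exact: sqrtr_ge0. Qed.

Lemma enormZ (a : R) u : enorm (a *: u) = `|a| * enorm u.
Proof.
by rewrite /enorm dotvZr dotvC dotvZr mulrA -expr2 sqrtrM ?sqr_ge0// sqrtr_sqr.
Qed.

Lemma dotv_le_enorm u v : dotv u v <= enorm u * enorm v.
Proof.
have [v0|v0] := eqVneq (dotv v v) 0.
  rewrite (dotv_eq0 v0) -(scale0r 0) dotvZr mul0r.
  by rewrite mulr_ge0// enorm_ge0.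
have vp : 0 < dotv v v by rewrite lt_neqAle eq_sym v0 dotv_ge0.
suff CS : dotv u v ^+ 2 <= dotv u u * dotv v v.
  apply: le_trans (ler_norm _) _.
  rewrite -(ler_pXn2r (n := 2))// ?nnegrE ?mulr_ge0 ?enorm_ge0//.
  by rewrite exprMn !enorm_sq real_normK// num_real.
(* dotv v v times the component of u orthogonal to v; its square is
   dotv v v times the Cauchy-Schwarz defect. *)
have := dotv_ge0 (dotv v v *: u + (- dotv u v) *: v).
rewrite dotvDr !dotvZr !(dotvC (_ + _)) !dotvDr !dotvZr (dotvC v u).
set a := dotv v v in vp *; set b := dotv u v; set c := dotv u u => h.
have : 0 <= a * (c * a - b ^+ 2) by lra.
by rewrite pmulr_rge0// subr_ge0.
Qed.
End Euclid.

(** * Second-order upper bound along a segment *)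

Section SecondOrder.
Variables (R : realType) (d : nat).
Implicit Types (u v x : 'rV[R]_d) (w : 'rV[R]_d -> R).

(** The difference quotients of w along the line and those of the directional
    derivative are the same function of the increment. *)
Lemma is_derive_line w x u (s : R) : derivable w (x + s *: u) u ->
  is_derive s (1 : R) (fun t : R => w (x + t *: u)) ('D_u w (x + s *: u)).
Proof.
move=> dw.
have E : (fun h : R => h^-1 *: (((fun t : R => w (x + t *: u)) \o shift s) (h *: (1 : R)) - w (x + s *: u)))
  = (fun h : R => h^-1 *: ((w \o shift (x + s *: u)) (h *: u) - w (x + s *: u))).
  apply/funext => h /=; congr (_ *: (w _ - _)).
  by rewrite scalerDl addrCA [h *: 1]mulr1.
by split; rewrite /derivable /derive E.
Qed.

Lemma derive_dotv_grad w x u : differentiable w x ->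
  'D_u w x = dotv (grad w x) u.
Proof.
move=> dw; rewrite deriveE// [u in LHS]row_sum_delta linear_sum.
by apply: eq_bigr => j _; rewrite linearZ/= -deriveE// mxE mulrC.
Qed.

(** Expanding the direction u in the coordinate basis turns the derivative of
    each partial derivative of w into a row of second partial derivatives; the
    resulting double sum is the quadratic form of the Hessian at u. *)
Lemma derive_dotv_hess w x u : differentiable (grad w) x ->
  is_derive x u (fun y => dotv (grad w y) u) (dotv u (hess w x *m u^T)^T).
Proof.
move=> dg.
have dgj j : differentiable (fun y => grad w y ord0 j) x.
  apply: (@differentiable_comp _ _ _ _ (grad w) (fun N : 'rV[R]_d => N ord0 j)) => //.
  exact: differentiable_coord.
have E : (fun y => dotv (grad w y) u) =
    \sum_(j < d) (fun y => u ord0 j *: grad w y ord0 j).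
  by apply/funext => y; rewrite fct_sumE; apply: eq_bigr => j _; rewrite mulrC.
rewrite E.
have -> : dotv u (hess w x *m u^T)^T =
    \sum_(j < d) u ord0 j *: 'D_u (fun y => grad w y ord0 j) x.
  under [RHS]eq_bigr => j _.
    rewrite deriveE// [X in _ *: 'd _ _ X]row_sum_delta linear_sum scaler_sumr.
    over.
  rewrite exchange_big/=; apply: eq_bigr => i _; rewrite !mxE mulr_sumr.
  apply: eq_bigr => j _; rewrite !mxE linearZ/= -deriveE//.
  by rewrite -[RHS]/(_ * (_ * _)) [RHS]mulrCA; congr (_ * _); rewrite mulrC.
apply: is_derive_sum => j.
apply: is_deriveZ; exact/derivableP/diff_derivable.
Qed.

(** The mean value theorem is applied to w along the segment and then to the
    derivative of that restriction. This loses the factor 1/2 of the Taylor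
    remainder, which is harmless because only summability of the remainders
    matters later. *)
Lemma second_order_upper_bound (U : set 'rV[R]_d) w (C : R) x u :
  (forall y, U y -> differentiable w y) ->
  (forall y, U y -> differentiable (grad w) y) ->
  (forall t : R, 0 <= t <= 1 -> U (x + t *: u)) ->
  (forall t : R, 0 <= t <= 1 ->
    dotv u (hess w (x + t *: u) *m u^T)^T <= C) -> 0 <= C ->
  w (x + u) <= w x + dotv (grad w x) u + C.
Proof.
move=> dw dg seg bnd C0.
have dphi (s : R) : 0 <= s <= 1 ->
    is_derive s (1 : R) (fun t : R => w (x + t *: u)) (dotv (grad w (x + s *: u)) u).
  move=> s01; rewrite -derive_dotv_grad; last exact/dw/seg.
  exact/is_derive_line/diff_derivable/dw/seg.
have dpsi (s : R) : 0 <= s <= 1 ->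
    is_derive s (1 : R) (fun t : R => dotv (grad w (x + t *: u)) u)
      (dotv u (hess w (x + s *: u) *m u^T)^T).
  move=> s01; have H := derive_dotv_hess u (dg _ (seg _ s01)).
  by rewrite -(derive_val (is_derive := H)); apply: (is_derive_line (w := fun y => dotv (grad w y) u)).
have cont (f df : R -> R) (a : R) : a <= 1 ->
    (forall s : R, 0 <= s <= 1 -> is_derive s (1 : R) f (df s)) ->
    {within `[0, a], continuous f}.
  move=> a1 df_; apply: derivable_within_continuous => s.
  rewrite in_itv/= => /andP[s0 sa].
  by have [] := df_ s; rewrite ?s0 ?(le_trans sa).
have mvt (f df : R -> R) (a : R) : 0 <= a <= 1 ->
    (forall s : R, 0 <= s <= 1 -> is_derive s (1 : R) f (df s)) ->
    exists2 c, 0 <= c <= a & f a - f 0 = df c * a.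
  move=> /andP[a0 a1] df_; have [||c] := @MVT_segment R f df 0 a a0.
  - move=> s; rewrite in_itv/= => /andP[s0 sa]; apply: df_.
    by rewrite (ltW s0) (le_trans (ltW sa)).
  - exact: cont df_.
  - by rewrite in_itv/= subr0 => c0a E; exists c.
have [c /andP[c0 c1]] := mvt _ _ 1 (ltac:(by rewrite ler01 lexx)) dphi.
have c01 : 0 <= c <= 1 by rewrite c0.
have [b /andP[b0 bc]] := mvt _ _ c c01 dpsi.
rewrite !scale0r !addr0 scale1r mulr1 => E1 E2.
have /bnd Hb : 0 <= b <= 1 by rewrite b0 (le_trans bc).
have : dotv u (hess w (x + b *: u) *m u^T)^T * c <= C.
  apply: le_trans (ler_wpM2r c0 Hb) _; rewrite -[leRHS]mulr1 ler_wpM2l//.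
lra.
Qed.

(** The supremum is -oo when Theta is empty or d = 0, hence the maximum with 0
    in the choice of C. The vector u = 0 is treated apart because it cannot be
    normalized. *)
Lemma hess_quadratic_bound (Theta : set 'rV[R]_d) w :
  (ereal_sup [set z | exists th u, [/\ Theta th, enorm u = 1%R &
              z = (enorm (hess w th *m u^T)^T)%:E]] < +oo)%E ->
  exists2 C : R, 0 <= C & forall x u, Theta x ->
    dotv u (hess w x *m u^T)^T <= C * dotv u u.
Proof.
set s := ereal_sup _ => soo.
exists (Num.max 0 (fine s)); first by rewrite le_max lexx.
move=> x u Tx; have [u0|u0] := eqVneq (dotv u u) 0.
  have -> : dotv u (hess w x *m u^T)^T = 0.
    by rewrite (dotv_eq0 u0) -[X in dotv X _](scale0r 0) dotvC dotvZr mul0r.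
  by rewrite u0 mulr0.
have nu0 : 0 < enorm u by rewrite sqrtr_gt0 lt_neqAle eq_sym u0 dotv_ge0.
pose e := (enorm u)^-1 *: u.
have e1 : enorm e = 1.
  by rewrite enormZ ger0_norm ?invr_ge0 ?enorm_ge0// mulVf// gt_eqF.
have ue : u = enorm u *: e by rewrite scalerA divff ?scale1r// gt_eqF.
have Hes : ((enorm (hess w x *m e^T)^T)%:E <= s)%E.
  by apply: ereal_sup_ubound; exists x, e.
have Hs : enorm (hess w x *m e^T)^T <= fine s.
  rewrite -lee_fin fineK//; apply: fin_real.
  by rewrite soo andbT (lt_le_trans _ Hes)// ltNyr.
apply: le_trans (dotv_le_enorm _ _) _.
have -> : enorm (hess w x *m u^T)^T = enorm u * enorm (hess w x *m e^T)^T.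
  rewrite [in LHS]ue !linearZ/= enormZ.
  by rewrite ger0_norm// ltW.
rewrite mulrA -expr2 -enorm_sq mulrC ler_wpM2r ?sqr_ge0//.
by rewrite le_max Hs orbT.
Qed.
End SecondOrder.

(** * Measurability and almost sure statements *)

Lemma measurable_open_borel_rV (R : realType) (d : nat) (U : set 'rV[R]_d) :
  open U -> measurable (U : set (borel_rV R d)).
Proof. exact: sub_sigma_algebra. Qed.

Lemma measurable_coord_borel_rV (R : realType) (d : nat) (j : 'I_d) :
  measurable_fun setT (fun v : borel_rV R d => (v : 'rV[R]_d) ord0 j).
Proof.
apply: (measurability _ (RGenOInfty.measurableE R)) => _ [_ [a ->]] <-.
rewrite setTI preimage_itvoy; apply: measurable_open_borel_rV.
apply: (open_comp (f := fun v : 'rV[R]_d => v ord0 j) (D := [set x | a < x])).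
  by move=> v _; exact: (@coord_continuous R 1 d ord0 j v).
exact: open_gt.
Qed.

(** The sublevel set is the difference of two open sets, U and the part of U
    where w exceeds M. *)
Lemma measurable_sublevel (R : realType) (d : nat) (U : set 'rV[R]_d)
    (w : 'rV[R]_d -> R) (M : R) :
  open U -> {in U, continuous w} ->
  measurable ([set v | U v /\ w v <= M] : set (borel_rV R d)).
Proof.
move=> oU cw.
have -> : [set v | U v /\ w v <= M] = U `\` (U `&` [set v | M < w v]).
  apply/seteqP; split=> v /=.
    by move=> [Uv wv]; split=> // -[_]; rewrite ltNge wv.
  by move=> [Uv nv]; split=> //; rewrite leNgt; apply/negP => wv; exact: nv.
apply: (@measurableD _ (borel_rV R d)); first exact: measurable_open_borel_rV.
apply: measurable_open_borel_rV; rewrite openE => v [Uv Mv].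
apply: filterI; first exact: open_nbhs_nbhs.
have cv : w y @[y --> v] --> w v by apply: cw; rewrite inE.
exact: cvgr_gt cv _ Mv.
Qed.

Lemma probability_ae1 (d : measure_display) (T : measurableType d)
    (R : realType) (P : probability T R) (A : set T) :
  measurable A -> (\forall x \ae P, A x) -> P A = 1%E.
Proof.
move=> mA aeA; rewrite -[A]setCK probability_setC; last exact: measurableC.
have -> : P (~` A) = 0%E; last by rewrite sube0.
by apply/negligibleP => //; exact: measurableC.
Qed.

(** Measurability of f is essential: otherwise its integral is only a lower
    integral, whose finiteness says nothing about the values of f. *)
Lemma ae_finite_of_integral (d : measure_display) (T : measurableType d)
    (R : realType) (P : probability T R) (f : T -> \bar R) :
  measurable_fun setT f -> (forall x, 0 <= f x)%E ->
  (\int[P]_x f x < +oo)%E -> \forall x \ae P, (f x < +oo)%E.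
Proof.
move=> mf f0 foo.
have fint : P.-integrable setT f.
  apply/integrableP; split => //; apply: le_lt_trans foo.
  by apply: ge0_le_integral => //; [exact: measurableT_comp|move=> x _; rewrite gee0_abs].
have := integrable_ae measurableT fint; apply: filterS => x /(_ I) fx.
by rewrite ltey_eq fx.
Qed.

Section Process.
Variables (R : realType) (d : nat) (dX dO : measure_display).
Variables (X : measurableType dX) (Omega : measurableType dO).
Variable S : sa_system R d X Omega.
Hypothesis hS : sa_setting S.

Lemma sa_theta_in i o : sa_R S i (sa_theta S i o).
Proof.
case: i => [|i]; first exact: sa_theta0.
by rewrite sa_recursion//; case: asboolP => // _; exact: sa_proj_in.
Qed.

Lemma sa_theta_Theta i o : sa_Theta S (sa_theta S i o).
Proof. exact: sa_R_sub (sa_theta_in i o). Qed.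

(** H is measurable only for the trace sigma-algebra on Theta, a set that need
    not be measurable. Since theta_i takes all its values in Theta, the preimage
    by (theta_i, X_(i+1)) does not see the difference between a trace set and
    the measurable set that it is cut from. *)
Lemma measurable_sa_incr i :
  measurable_fun setT (sa_incr S i : Omega -> borel_rV R d).
Proof.
move=> _ B mB; rewrite setTI.
have [C mC HC] := sa_H_measurable hS mB.
pose p o : borel_rV R d * X := (sa_theta S i o, sa_X S i.+1 o).
have -> : sa_incr S i @^-1` B = setT `&` p @^-1` C.
  rewrite setTI; apply/seteqP; split=> o /= Bo.
    suff [] : ([set q : borel_rV R d * X | sa_Theta S q.1] `&` C) (p o) by [].
    by rewrite -HC; split => //; exact: sa_theta_Theta.
  suff [] : ([set q : borel_rV R d * X | sa_Theta S q.1] `&`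
    (fun q : borel_rV R d * X => sa_H S q.1 q.2) @^-1` B) (p o) by [].
  by rewrite HC; split => //; exact: sa_theta_Theta.
apply: measurable_fun_pair => //.
  exact: sa_theta_measurable.
exact: sa_X_measurable.
Qed.

Lemma measurable_sa_step_sq i : measurable_fun setT
  (fun o => sa_Gamma S i.+1 o ^+ 2 * enorm (sa_incr S i o) ^+ 2).
Proof.
under eq_fun do rewrite enorm_sq.
apply: measurable_funM; first exact/measurable_funX/sa_Gamma_measurable.
apply: measurable_sum => j.
have mj : measurable_fun setT (fun o => sa_incr S i o ord0 j).
  exact: measurableT_comp (measurable_coord_borel_rV j) (measurable_sa_incr i).
exact: measurable_funM.
Qed.

Lemma sa_step_sq_ae_finite th x :
  (\int[sa_prob S th x]_o
     (\sum_(0 <= i <oo)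
        (sa_Gamma S i.+1 o ^+ 2 * enorm (sa_incr S i o) ^+ 2)%:E) < +oo)%E ->
  \forall o \ae sa_prob S th x,
    (\sum_(0 <= i <oo)
        (sa_Gamma S i.+1 o ^+ 2 * enorm (sa_incr S i o) ^+ 2)%:E < +oo)%E.
Proof.
have sq0 i o : (0 <= (sa_Gamma S i.+1 o ^+ 2 * enorm (sa_incr S i o) ^+ 2)%:E)%E.
  by rewrite lee_fin mulr_ge0// sqr_ge0.
apply: ae_finite_of_integral => [|o]; last exact: nneseries_ge0.
apply: (ge0_emeasurable_sum (P := xpredT)) => // i _.
exact/measurable_EFinP/measurable_sa_step_sq.
Qed.

Lemma measurable_sa_sublevel (w : 'rV[R]_d -> R) (M : R) n :
  C2_on (sa_Theta S) w ->
  measurable [set o | sublevel (sa_Theta S) w M (sa_theta S n o)].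
Proof.
move=> [U [oU TU dw _ _]].
have -> : [set o | sublevel (sa_Theta S) w M (sa_theta S n o)] =
    setT `&` sa_theta S n @^-1` [set v | U v /\ w v <= M].
  rewrite setTI; apply/seteqP; split=> o /= [To wo]; split => //; first exact: TU.
  exact: sa_theta_Theta.
apply: sa_theta_measurable => //; apply: measurable_sublevel => // v.
by rewrite inE => /dw /differentiable_continuous.
Qed.

(** The step to theta^*_(i+1) is controlled by the second-order bound, and the
    projection can only decrease w. *)
Lemma sa_lyapunov_step (w : 'rV[R]_d -> R) (C : R) i o :
  C2_on (sa_Theta S) w -> 0 <= C ->
  (forall x u, sa_Theta S x ->
    dotv u (hess w x *m u^T)^T <= C * dotv u u) ->
  (forall t : R, 0 <= t <= 1 -> sa_Theta S
    (sa_theta S i o + t *: (sa_star S i o - sa_theta S i o))) ->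
  (~ sa_R S i.+1 (sa_star S i o) ->
    w (sa_proj S i.+1 o) <= w (sa_star S i o)) ->
  w (sa_theta S i.+1 o) <= w (sa_theta S i o)
    + sa_Gamma S i.+1 o * dotv (grad w (sa_theta S i o)) (sa_incr S i o)
    + C * (sa_Gamma S i.+1 o ^+ 2 * enorm (sa_incr S i o) ^+ 2).
Proof.
move=> [U [_ TU dw dg _]] C0 hC seg proj.
have le_star : w (sa_theta S i.+1 o) <= w (sa_star S i o).
  by rewrite sa_recursion//; case: asboolP.
apply: le_trans le_star _.
set u := sa_Gamma S i.+1 o *: sa_incr S i o.
have Eu : sa_star S i o - sa_theta S i o = u by rewrite /sa_star addrC addKr.
have Euu : dotv u u = sa_Gamma S i.+1 o ^+ 2 * enorm (sa_incr S i o) ^+ 2.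
  by rewrite -enorm_sq enormZ exprMn real_normK// num_real.
rewrite -Euu -dotvZr; apply: (second_order_upper_bound (u := u) dw dg).
- by move=> t t01; apply: TU; rewrite -Eu; exact: seg.
- by move=> t t01; apply: hC; rewrite -Eu; exact: seg.
- by rewrite mulr_ge0// dotv_ge0.
Qed.

End Process.

(** * Sums over late blocks *)

Section Series.
Variable R : realType.

(** All late blocks are differences of two blocks starting at one fixed N, so
    the supremum at a single index N suffices. *)
Lemma small_blocks_of_tail_sup (f : nat -> R) :
  ereal_sup [set (`|\sum_(m <= i < k.+1) f i|)%:E
            | k in [set k : nat | (m < k)%N]] @[m --> \oo] --> (0 : \bar R) ->
  forall eps, 0 < eps -> exists N, forall a b, (N <= a <= b)%N ->
    \sum_(a <= i < b) f i <= eps.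
Proof.
move=> f0 eps eps0; have eps2 : (0 : R) < eps / 2 by lra.
have [N _ /(_ _ (leqnn N))/= supN] := f0 _ (nbhs_open_ereal_lt (f := fun=> eps / 2) eps2).
have fromN c : (N.+2 <= c)%N -> `|\sum_(N <= i < c) f i| <= eps / 2.
  case: c => // c Nc; rewrite -lee_fin (le_trans _ (ltW supN))//.
  by apply: ereal_sup_ubound; exists c.
(* The suprema bound blocks from N with at least two terms, hence N.+2. *)
exists N.+2 => a b /andP[Na ab].
have : `|\sum_(N <= i < b) f i| <= eps / 2 by apply: fromN; exact: leq_trans Na ab.
rewrite (big_cat_nat (n := a))//=; last by rewrite ltnW// ltnW.
by move/fromN: Na; rewrite !ler_norml => /andP[? ?] /andP[? ?]; lra.
Qed.

Lemma small_blocks_of_finite_series (f : nat -> R) :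
  (forall i, 0 <= f i) -> (\sum_(0 <= i <oo) (f i)%:E < +oo)%E ->
  forall eps, 0 < eps -> exists N, forall a b, (N <= a <= b)%N ->
    \sum_(a <= i < b) f i <= eps.
Proof.
move=> f0 foo eps eps0.
have tail := nneseries_tail_cvg foo (fun i _ => f0 i).
have [N _ tailN] := tail _ (nbhs_open_ereal_lt (f := fun=> eps) eps0).
exists N => a b /andP[Na _]; rewrite -lee_fin (le_trans _ (ltW (tailN _ Na)))//=.
by rewrite -sumEFin; apply: nneseries_lim_ge => i _ _; rewrite lee_fin.
Qed.

(** The shift matches the increments Gamma_(i+1) with the divergent series in
    Gamma_i delta_i. The maximum with 0 accounts for the empty blocks. *)
Lemma unbounded_blocks_of_divergence (f : nat -> \bar R) (g : nat -> R) (m : nat) :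
  (forall i, (m <= i)%N -> (0 <= f i.+1 <= (g i)%:E)%E) ->
  (\sum_(m.+1 <= i <oo) f i = +oo)%E ->
  forall B, exists2 n, (m <= n)%N & B < \sum_(m <= i < n) g i.
Proof.
move=> fg foo B; apply: contrapT => bounded.
suff : (\sum_(m.+1 <= i <oo) f i <= (Num.max 0 B)%:E)%E by rewrite foo.
apply: lime_le.
  by apply: is_cvg_nneseries => -[|i]// mi _; have /andP[] := fg _ mi.
apply: nearW => n; rewrite big_add1.
have [mn|nm] := leqP m n.-1; last first.
  by rewrite big_geq 1?ltnW// lee_fin le_max lexx.
apply: (@le_trans _ _ (\sum_(m <= i < n.-1) (g i)%:E)%E).
  rewrite big_nat_cond [leRHS]big_nat_cond; apply: lee_sum => i.
  by rewrite andbT => /andP[mi _]; have /andP[] := fg _ mi.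
rewrite sumEFin lee_fin le_max; apply/orP; right.
by rewrite leNgt; apply/negP => Bn; apply: bounded; exists n.-1.
Qed.

End Series.

(** * One trajectory of the process *)

Section Trajectory.
Variables (R : realType) (d : nat) (dX dO : measure_display).
Variables (X : measurableType dX) (Omega : measurableType dO).
Variables (S : sa_system R d X Omega) (w : 'rV[R]_d -> R) (M0 : R).
Hypothesis hS : sa_setting S.
Hypothesis hW : condition_W S w M0.

Lemma sa_delta_nonincreasing i j :
  (i <= j)%N -> (sa_delta S w M0 j <= sa_delta S w M0 i)%E.
Proof.
move=> ij; apply: ereal_inf_le_tmp => _ [th [Ri nW] <-]; exists th => //.
split => //; move: Ri.
exact: (@homo_leq _ (sa_R S) (@subset _) (@subset_refl _)
  (fun B A D => @subset_trans _ B A D) (W_incr hW) _ _ ij).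
Qed.

(** The decrease of w produced by the mean field over one step. *)
Definition sa_dissipation (i : nat) (o : Omega) : R :=
  - (sa_Gamma S i.+1 o
     * dotv (grad w (sa_theta S i o)) (sa_h S (sa_theta S i o))).

(** theta_i is one of the points over which the infimum delta_i is taken, and
    delta_(i+1) <= delta_i; the index i+1 is the one that comes with
    Gamma_(i+1) in the divergent series. *)
Lemma sa_dissipation_ge i o : M0 < w (sa_theta S i o) ->
  ((sa_Gamma S i.+1 o)%:E * sa_delta S w M0 i.+1 <= (sa_dissipation i o)%:E)%E.
Proof.
move=> Mw; rewrite /sa_dissipation -mulrN EFinM.
rewrite lee_wpmul2l ?lee_fin ?sa_Gamma_ge0//.
apply: le_trans (sa_delta_nonincreasing (leqnSn i)) _.
apply: ereal_inf_lbound; exists (sa_theta S i o) => //.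
by split; [exact: sa_theta_in|move=> [_]; rewrite leNgt Mw].
Qed.


(** The descent lemma applied to w(theta_i), with the mean-field decrease as g
    and the noise plus the second-order remainder as e. *)
Lemma sa_path_tail (o : Omega) :
  (forall i, (0 < sa_delta S w M0 i)%E) ->
  (forall i (t : R), 0 <= t <= 1 -> sa_Theta S
    (sa_theta S i o + t *: (sa_star S i o - sa_theta S i o))) ->
  (forall i, ~ sa_R S i.+1 (sa_star S i o) ->
    sa_R S i.+1 (sa_proj S i.+1 o) /\
    w (sa_proj S i.+1 o) <= w (sa_star S i o)) ->
  sa_Gamma S i.+1 o * enorm (grad w (sa_theta S i o))
    * enorm (sa_incr S i o) @[i --> \oo] --> (0 : R) ->
  (\sum_(0 <= i <oo)
    (sa_Gamma S i.+1 o ^+ 2 * enorm (sa_incr S i o) ^+ 2)%:E < +oo)%E ->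
  sa_delta_divergence S w M0 o ->
  ereal_sup [set (`|\sum_(m <= i < k.+1) sa_noise S w i o|)%:E
            | k in [set k : nat | (m < k)%N]] @[m --> \oo] --> (0 : \bar R) ->
  forall eps, 0 < eps ->
  exists m, forall n, (m <= n)%N -> w (sa_theta S n o) <= M0 + eps.
Proof.
move=> delta0 seg proj jump0 sq_fin div noise0.
have [C C0 hC] := hess_quadratic_bound (W_hess hW).
pose rem i := C * (sa_Gamma S i.+1 o ^+ 2 * enorm (sa_incr S i o) ^+ 2).
have rem0 i : 0 <= rem i by do 2?apply: mulr_ge0 => //; exact: sqr_ge0.
have small_noise := small_blocks_of_tail_sup noise0.
have small_rem : forall eps, 0 < eps -> exists N, forall a b,
    (N <= a <= b)%N -> \sum_(a <= i < b) rem i <= eps.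
  apply: small_blocks_of_finite_series => //.
  under eq_eseriesr do rewrite EFinM.
  rewrite nneseriesZl; last by move=> i _; rewrite lee_fin mulr_ge0// sqr_ge0.
  by rewrite lte_mul_pinfty ?lee_fin.
have step i : w (sa_theta S i.+1 o) <= w (sa_theta S i o)
    + sa_Gamma S i.+1 o * dotv (grad w (sa_theta S i o)) (sa_incr S i o)
    + rem i.
  by apply: sa_lyapunov_step => //; [exact: W_C2 hW|exact: seg|move=> /proj[]].
apply: (@descent_tail R (fun i => w (sa_theta S i o))
  (fun i => sa_dissipation i o) (fun i => sa_noise S w i o + rem i)).
- by move=> i; apply: W_ge0 hW _ _; exact: sa_theta_Theta.
- move=> i Mw; rewrite /sa_dissipation oppr_ge0 mulr_ge0_le0 ?sa_Gamma_ge0//.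
  apply: W_drift hW _ _; split; last by exists i => //; exact: sa_theta_in.
  by move=> -[_]; rewrite leNgt Mw.
- move=> i _; apply: le_trans (step i) _.
  have -> : sa_incr S i o = sa_h S (sa_theta S i o)
      + sa_Hbar S (sa_theta S i o) (sa_X S i.+1 o).
    by rewrite /sa_Hbar addrC subrK.
  rewrite dotvDr mulrDr /sa_dissipation /sa_noise; lra.
- move=> eps eps0; have eps2 : 0 < eps / 2 by lra.
  have [N1 _ jumpN1] := (cvgr0Pnorm_le _).1 jump0 _ eps2.
  have [N2 remN2] := small_rem _ eps2.
  exists (maxn N1 N2) => i; rewrite geq_max => /andP[N1i N2i] wi.
  have := remN2 i i.+1; rewrite N2i leqnSn big_nat1 => /(_ isT) remi.
  have := le_trans (ler_norm _) (jumpN1 _ N1i).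
  (* The whole increment, drift included, is bounded by Cauchy-Schwarz: the
     drift has no sign inside the sublevel set. *)
  have := step i; have := ler_wpM2l (sa_Gamma_ge0 hS i o)
    (dotv_le_enorm (grad w (sa_theta S i o)) (sa_incr S i o)).
  rewrite mulrA; lra.
- move=> eps eps0; have eps2 : 0 < eps / 2 by lra.
  have [N1 noiseN1] := small_noise _ eps2.
  have [N2 remN2] := small_rem _ eps2.
  exists (maxn N1 N2) => a b; rewrite geq_max => /andP[/andP[N1a N2a] ab].
  rewrite big_split/=.
  have := noiseN1 a b; have := remN2 a b; rewrite N1a N2a ab.
  by move=> /(_ isT) ? /(_ isT) ?; lra.
- move=> m above; apply: unbounded_blocks_of_divergence (div m.+1 _) => // i mi.
  rewrite sa_dissipation_ge ?above// andbT.
  by rewrite mule_ge0 ?lee_fin ?sa_Gamma_ge0// ltW.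
Qed.

End Trajectory.

(** * Almost sure containment of the tails *)

Theorem theorem2p8 (R : realType) (d : nat) (dX dO : measure_display)
    (X : measurableType dX) (Omega : measurableType dO)
    (S : sa_system R d X Omega) (w : 'rV[R]_d -> R) (M0 : R)
    (hS : sa_setting S)
    (hTheta : sa_steps_in_Theta S)
    (hW : condition_W S w M0)
    (hN1 : forall th x, sa_R S 0%N th ->
      \forall o \ae sa_prob S th x,
        sa_Gamma S i.+1 o * enorm (grad w (sa_theta S i o))
          * enorm (sa_incr S i o) @[i --> \oo] --> (0 : R))
    (hN2 : forall th x, sa_R S 0%N th ->
      (\int[sa_prob S th x]_o
         (\sum_(0 <= i <oo)
            (sa_Gamma S i.+1 o ^+ 2 * enorm (sa_incr S i o) ^+ 2)%:E)
       < +oo)%E)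
    (hN3 : forall th x, sa_R S 0%N th ->
      (\int[sa_prob S th x]_o
         ereal_sup (range (fun k : nat =>
           (`|\sum_(0 <= i < k.+1) sa_noise S w i o|)%:E))
       < +oo)%E)
    (hD : forall th x, sa_R S 0%N th ->
      (forall i, (0 < sa_delta S w M0 i)%E) /\
      \forall o \ae sa_prob S th x, sa_delta_divergence S w M0 o)
    (hN4 : forall th x, sa_R S 0%N th ->
      \forall o \ae sa_prob S th x,
        ereal_sup [set (`|\sum_(m <= i < k.+1) sa_noise S w i o|)%:E
                  | k in [set k : nat | (m < k)%N]] @[m --> \oo] --> (0 : \bar R)) :
  forall M : R, M0 < M -> forall th x, sa_R S 0%N th ->
    sa_prob S th x
      (\bigcup_m \bigcap_(n in [set n : nat | (m <= n)%N])
         [set o | sublevel (sa_Theta S) w M (sa_theta S n o)]) = 1%E.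
Proof.
move=> M M0M th x R0.
apply: probability_ae1.
  apply: bigcup_measurable => m _; apply: bigcap_measurable; first by exists m => /=.
  by move=> n _; apply: measurable_sa_sublevel => //; exact: W_C2 hW.
have [delta0 div] := hD _ x R0.
move: (hTheta _ x R0) (W_proj hW x R0) (hN1 _ x R0).
apply: filter_app3.
move: (sa_step_sq_ae_finite hS (hN2 _ x R0)) div (hN4 _ x R0).
apply: filterS3 => o sq_fin divo noise seg proj jump.
have gap : 0 < M - M0 by rewrite subr_gt0.
have [m tail] := sa_path_tail hS hW delta0 seg proj jump sq_fin divo noise gap.
exists m => // n /tail; rewrite addrC subrK => wn.
by split => //; exact: sa_theta_Theta.
Qed.
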